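(* For every positive integer $n\equiv 0 \pmod 4$ there exists a shiftable $(n^2,n;3)$ Heffter space.
   Context: For integers $a\le b$, $[a,b]$ denotes the set of integers $x$ with $a\le x\le b$. A $(v,k;r)$ space is a resolvable $(v_r,b_k)$ configuration with $b=\frac{vr}{k}$: a point-block incidence structure $(V,\mathcal B)$ with $|V|=v$ points, each lying in exactly $r$ blocks, and $b$ blocks, each a subset of $V$ of size $k$, such that any two distinct points lie together in at most one block, and such that $\mathcal B$ can be partitioned into parallel classes, each of which is a partition of $V$. Equivalently, it is given by a collection (called a resolution) of $r$ mutually orthogonal partitions of a $v$-set $V$ into subsets of size $k$, where two partitions $\mathcal P,\mathcal Q$ of $V$ are orthogonal if every part of $\mathcal P$ has at most one element in common with every part of $\mathcal Q$. A half-set of $[-v,v]$ is a subset $V\subseteq[-v,v]$ such that $V$ and $-V$ form a partition of $[-v,v]\setminus\{0\}$. An integer $(v,k;r)$ Heffter space is a $(v,k;r)$ space whose point set is a half-set of $[-v,v]$ and each of whose blocks has elements summing to $0$ in $\mathbb Z$. It is called shiftable if $k$ is even and each block contains exactly $\frac{k}{2}$ positive elements. A shiftable Heffter space is always understood to be integer. *)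

(* Defs.v *)
From mathcomp Require Import all_boot all_order all_algebra.
From mathcomp Require Import finmap.

Set Implicit Arguments.
Unset Strict Implicit.
Unset Printing Implicit Defensive.

Import Order.TTheory GRing.Theory Num.Theory.

Local Open Scope ring_scope.
Local Open Scope fset_scope.

Definition fpartition (T : choiceType) (P : {fset {fset T}}) (D : {fset T}) :=
  [&& fcover P == D, trivIfset P & fset0 \notin P].

Section Configurations.

Variable K : choiceType.
Implicit Types (V : {fset K}) (B : {fset {fset K}}).

(* The last field encodes b = v r / k, where b is the number of blocks. *)
Record configuration (v k r : nat) V B : Prop := Configuration {
  conf_points : #|` V| = v;
  conf_block_sub : forall A, A \in B -> A `<=` V;
  conf_block_card : forall A, A \in B -> #|` A| = k;
  conf_degree : forall x, x \in V -> #|` [fset A in B | x \in A]| = r;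
  conf_linear : forall x y, x \in V -> y \in V -> x != y ->
    (#|` [fset A in B | (x \in A) && (y \in A)]| <= 1)%N;
  conf_blocks : (#|` B| * k = v * r)%N
}.

Definition resolvable V B : Prop :=
  exists2 R : {fset {fset {fset K}}},
    fpartition R B &
    forall P, P \in R -> fpartition P V.

Definition space (v k r : nat) V B : Prop :=
  configuration v k r V B /\ resolvable V B.

End Configurations.

Definition half_set (v : nat) (V : {fset int}) : Prop :=
  let oppV : {fset int} := [fset - x | x in V] in
  [disjoint V & oppV] /\
  forall x : int, (x \in V `|` oppV) = (- v%:Z <= x <= v%:Z) && (x != 0).

Definition integer_Heffter_space (v k r : nat)
    (V : {fset int}) (B : {fset {fset int}}) : Prop :=
  [/\ space v k r V B,
      half_set v V
    & forall A : {fset int}, A \in B -> \sum_(x <- A) x = 0].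

Definition shiftable_Heffter_space (v k r : nat)
    (V : {fset int}) (B : {fset {fset int}}) : Prop :=
  [/\ integer_Heffter_space v k r V B,
      ~~ odd k
    & forall A : {fset int}, A \in B -> #|` [fset x in A | (0 : int) < x]| = k./2].

(* Main.v *)
(* For n = 4 a signed 4x4 array with entries of absolute values 1, ..., 16 is
   exhibited, whose rows, columns and broken diagonals all have sum zero and two
   positive entries.  Since signs are balanced on each line, adding a constant
   to all the absolute values preserves the sums.  For n = 4m, an m x m array of
   copies of the 4x4 array, shifted by 0, 16, 32, ..., is the required space:
   points are pairs (x, y) in G * G with G = Z/m * Z/4, and the three parallel
   classes are the fibers of x, y and x + y. *)

Require Import Defs.
From mathcomp Require Import all_boot all_order all_algebra.
From mathcomp Require Import finmap.
From mathcomp Require Import zify.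

Set Implicit Arguments.
Unset Strict Implicit.
Unset Printing Implicit Defensive.

Import Order.TTheory GRing.Theory Num.Theory.

Local Open Scope fset_scope.

(** * Images of finite types as finite sets *)

Section FinImfset.

Variables (T : finType) (K : choiceType).

Lemma big_imfset_fin (R : Type) (idx : R) (op : Monoid.com_law idx)
    (h : T -> K) (P : finmempred T) (G : K -> R) : injective h ->
  \big[op/idx]_(x <- imfset imfset_key h P) G x
    = \big[op/idx]_(x in P) G (h x).
Proof.
move=> h_inj; rewrite big_imfset => [|x y _ _ /h_inj //].
rewrite -[RHS]big_enum; apply: perm_big.
apply: uniq_perm => [||x]; rewrite ?enum_finmem_uniq ?enum_uniq //.
by rewrite enum_finmemE mem_enum.
Qed.

Lemma card_imfset_fin (h : T -> K) (P : finmempred T) : injective h ->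
  #|` imfset imfset_key h P| = #|P|.
Proof.
move=> h_inj.
by rewrite -sum1_card -(big_imfset_fin _ _ (fun=> 1) h_inj) sum1_size.
Qed.

(** Serves both levels of a resolution: the classes partition the blocks, and the blocks of a class
    partition the points. *)
Lemma fpartition_imfset (F : T -> {fset K}) (V : {fset K}) :
  (forall x, reflect (exists i, x \in F i) (x \in V)) ->
  (forall i j x, x \in F i -> x \in F j -> i = j) ->
  (forall i, F i != fset0) ->
  fpartition [fset F i | i in T] V.
Proof.
move=> coverF disjF F_neq0; apply/and3P; split.
- apply/eqP/fsetP => x; apply/bigfcupP/coverF => [[A]|[i Fix]].
    by rewrite andbT => /imfsetP[/= i _ ->] Fix; exists i.
  by exists (F i); rewrite ?andbT ?in_imfset.
- apply/trivIfsetP => _ _ /imfsetP[/= i _ ->] /imfsetP[/= j _ ->] Fij.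
  apply/fdisjointP => x Fix; apply: contra Fij => Fjx.
  by rewrite (disjF _ _ _ Fix Fjx).
- by apply/imfsetP => -[/= i _ /eqP]; rewrite eq_sym (negPf (F_neq0 i)).
Qed.

End FinImfset.

(** * Resolvable configurations from the fibers of pairwise orthogonal maps *)

Section Resolution.

Variables (T C D : finType) (K : choiceType) (val : T -> K) (f : D -> T -> C).
Variable k : nat.

(** The index [l] pairs a direction, which names a parallel class, with a value, which names a block
    of that class. *)
Definition fiber_block (l : D * C) : {fset K} :=
  [fset val p | p in [pred p | f l.1 p == l.2]].

Definition points : {fset K} := [fset val p | p in T].

Definition blocks : {fset {fset K}} := [fset fiber_block l | l in {: D * C}].

Hypothesis val_inj : injective val.
Hypothesis k_gt1 : 1 < k.
Hypothesis card_fiber : forall d c, #|[pred p | f d p == c]| = k.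
Hypothesis orthogonal : forall d e p q,
  d != e -> f d p = f d q -> f e p = f e q -> p = q.

Lemma mem_fiber_block l p : (val p \in fiber_block l) = (f l.1 p == l.2).
Proof. by rewrite mem_imfset. Qed.

Lemma fiber_blockP l x :
  reflect (exists2 p, f l.1 p = l.2 & x = val p) (x \in fiber_block l).
Proof.
apply: (iffP (imfsetP _ _ _ _)) => -[p /=]; first by move/eqP; exists p.
by move=> /eqP fp ->; exists p.
Qed.

Lemma pointsP x : reflect (exists p, x = val p) (x \in points).
Proof.
by apply: (iffP (imfsetP _ _ _ _)) => [[p _]|[p]] ->; exists p.
Qed.

Lemma blocksP A : reflect (exists l, A = fiber_block l) (A \in blocks).
Proof.
by apply: (iffP (imfsetP _ _ _ _)) => [[l _]|[l]] ->; exists l.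
Qed.

Lemma card_fiber_block l : #|` fiber_block l| = k.
Proof. by rewrite card_imfset_fin // -(card_fiber l.1 l.2); apply: eq_card. Qed.

Lemma fiber_two_points l :
  exists p q, [/\ p != q, f l.1 p = l.2 & f l.1 q = l.2].
Proof.
have := k_gt1; rewrite -(card_fiber l.1 l.2) => /card_gt1P [p [q []]].
by rewrite !inE => /eqP fp /eqP fq pq; exists p, q.
Qed.

(** In different directions, orthogonality would force [p = q]; in a common direction, the value at
    [p] decides the block. *)
Lemma fiber_block_line l m p q : p != q ->
  val p \in fiber_block l -> val q \in fiber_block l ->
  val p \in fiber_block m -> val q \in fiber_block m -> l = m.
Proof.
rewrite !mem_fiber_block; case: l m => d c [e c'] /= pq.
move=> /eqP dp /eqP dq /eqP ep /eqP eq.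
case: (eqVneq d e) => [de|de]; first by rewrite -dp -ep de.
by case/eqP: pq; apply: orthogonal de _ _; congruence.
Qed.

(** As [k > 1], a block has two distinct points, and these determine its index. *)
Lemma fiber_block_inj : injective fiber_block.
Proof.
move=> l m lm; have [p [q [pq /eqP fp /eqP fq]]] := fiber_two_points l.
by apply: (fiber_block_line pq); rewrite -?lm mem_fiber_block.
Qed.

Lemma card_fibers (d : D) : #|T| = #|C| * k.
Proof.
rewrite -[LHS]sum1_card (partition_big (f d) predT) //= -sum_nat_const.
by apply: eq_bigr => c _; rewrite sum1dep_card -(card_fiber d c) cardsE.
Qed.

Lemma fiber_configuration : configuration #|T| k #|D| points blocks.
Proof.
split=> [|A /blocksP[l ->]|A /blocksP[l ->]|x|x y|].
- by rewrite card_imfset_fin.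
- by apply/fsubsetP => x /fiber_blockP[p _ ->]; apply/pointsP; exists p.
- exact: card_fiber_block.
- case/pointsP=> p ->.
  (* Exactly one block in each direction passes through [p]. *)
  suff ->: [fset A in blocks | val p \in A]
         = [fset fiber_block (d, f d p) | d in D].
    by rewrite card_imfset_fin // => d e /fiber_block_inj [].
  apply/fsetP => A; rewrite !inE; apply/andP/imfsetP => /= [[]|[d _ ->]].
    move=> /blocksP[[d c] ->]; rewrite mem_fiber_block /= => /eqP <-.
    by exists d.
  by split; [apply/blocksP; eexists | rewrite mem_fiber_block].
- case/pointsP=> p -> /pointsP[q ->]; rewrite (inj_eq val_inj) => pq.
  set B := [fset A in _ | _].
  case: (eqVneq B fset0) => [->|/fset0Pn[A BA]]; first by rewrite cardfs0.
  rewrite -(cardfs1 A) fsubset_leq_card //; apply/fsubsetP => A' BA'.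
  move: BA BA'; rewrite !inE => /and3P[/blocksP[l ->] lp lq].
  case/and3P=> /blocksP[m ->] mp mq.
  by rewrite (fiber_block_line pq lp lq mp mq).
- rewrite card_imfset_fin; last exact: fiber_block_inj.
  (* If there is no direction, both counts vanish; otherwise some direction [d] splits [T] into
     fibers of size [k]. *)
  rewrite card_prod -mulnA mulnC; case: (posnP #|D|) => [->|].
    by rewrite !muln0.
  by case/card_gt0P => d _; rewrite -(card_fibers d).
Qed.

Hypothesis c0 : C.

(** The class of direction [d] consists of all fibers of [f d]; the value [c0] shows that it is
    nonempty. *)
Lemma fiber_resolvable : resolvable points blocks.
Proof.
exists [fset [fset fiber_block (d, c) | c in C] | d in D].
  apply: fpartition_imfset => [A|d e A|d].
  - apply: (iffP (blocksP A)) => [[[d c] ->]|[d /imfsetP[/= c _ ->]]].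
      by exists d; apply: in_imfset.
    by exists (d, c).
  - by move=> /imfsetP[/= c _ ->] /imfsetP[/= c' _ /fiber_block_inj[]].
  - by apply/fset0Pn; exists (fiber_block (d, c0)); apply: in_imfset.
move=> _ /imfsetP[/= d _ ->]; apply: fpartition_imfset => [x|c c' x|c].
- apply: (iffP (pointsP x)) => [[p ->]|[c /fiber_blockP[p _ ->]]].
    by exists (f d p); rewrite mem_fiber_block.
  by exists p.
- by move=> /fiber_blockP[p /= <- ->]; rewrite mem_fiber_block => /eqP.
- by rewrite -cardfs_gt0 card_fiber_block ltnW.
Qed.

End Resolution.

(** * Half-sets from absolute values *)

Section HalfSet.

Variables (T : finType) (val : T -> int).
Hypothesis abs_inj : injective (fun p => `|val p|%N).
Hypothesis abs_bounds : forall p, 0 < `|val p|%N <= #|T|.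

(** Pigeonhole: lowered by one, the absolute values give an injection of [T] into the ordinals below
    [#|T|], hence a bijection. *)
Lemma abs_surj y : 0 < y <= #|T| -> exists p, `|val p|%N = y.
Proof.
have lt_abs p : `|val p|%N.-1 < #|T| by case/andP: (abs_bounds p); lia.
have ord_inj : injective (fun p => Ordinal (lt_abs p)).
  move=> p q [pq]; apply: abs_inj => /=.
  by move: (abs_bounds p) (abs_bounds q); lia.
move=> /andP[y_gt0 yT]; have lt_y : y.-1 < #|T| by lia.
have [|p] := codomP (inj_card_onto ord_inj _ (Ordinal lt_y)).
  by rewrite card_ord.
by move=> [eq_y]; exists p; move: (abs_bounds p); lia.
Qed.

Lemma half_set_points : half_set #|T| (points val).
Proof.
have mem_opp x :
    (x \in [fset (- y)%R | y in points val]) = ((- x)%R \in points val).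
  apply/imfsetP/idP => [[/= y Vy ->]|Vx]; first by rewrite opprK.
  by exists (- x)%R; rewrite ?opprK.
split=> [|x].
  apply/fdisjointP => _ /pointsP[p ->]; rewrite mem_opp.
  apply/pointsP => -[q pq].
  (* Opposite values have the same absolute value, so they come from one point, whose value would be
     zero. *)
  have eq_pq : p = q by apply: abs_inj => /=; lia.
  by move: (abs_bounds p) pq; rewrite eq_pq; lia.
rewrite inE mem_opp; apply/idP/idP => [|x_bounds].
  by case/orP=> /pointsP[p px]; move: (abs_bounds p); lia.
have [|p abs_p] := @abs_surj `|x|%N; first by lia.
have [px|px] : x = val p \/ (- x)%R = val p by lia.
  by apply/orP; left; apply/pointsP; exists p.
by apply/orP; right; apply/pointsP; exists p.
Qed.

End HalfSet.

(** Reduces the construction to conditions on [val] and [f]: since [val] is injective, sums over a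
    block are sums over a fiber. *)
Lemma fiber_shiftable (T C D : finType) (val : T -> int) (f : D -> T -> C)
    (k : nat) (c0 : C) :
  injective (fun p => `|val p|%N) ->
  (forall p, 0 < `|val p|%N <= #|T|) ->
  1 < k -> ~~ odd k ->
  (forall d c, #|[pred p | f d p == c]| = k) ->
  (forall d e p q, d != e -> f d p = f d q -> f e p = f e q -> p = q) ->
  (forall d c, \sum_(p | f d p == c) val p = 0)%R ->
  (forall d c, \sum_(p | f d p == c) (0 < val p)%R = k./2) ->
  shiftable_Heffter_space #|T| k #|D| (points val) (blocks val f).
Proof.
move=> abs_inj abs_bounds k_gt1 k_even card_f orth sum0 pos.
have val_inj : injective val by move=> p q pq; apply: abs_inj; rewrite pq.
split=> //; first split.
- split; first exact: fiber_configuration.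
  exact: (fiber_resolvable val_inj k_gt1).
- exact: half_set_points.
- move=> A /blocksP[l ->]; rewrite big_imfset_fin //.
  exact: etrans (sum0 l.1 l.2).
(* The positive elements are counted by summing the truth value of [0 < x] over the block. *)
- move=> A /blocksP[l ->]; rewrite -(pos l.1 l.2) -sum1_size -big_fset_condE.
  by rewrite big_mkcond big_imfset_fin.
Qed.

(** * Lines in three directions of [G * G], and the 4x4 array *)

Section ShiftedCopies.

Local Open Scope ring_scope.

Definition direction (G : zmodType) (d : 'I_3) (p : G * G) : G :=
  match val d with 0%N => p.1 | 1%N => p.2 | _ => p.1 + p.2 end.

(** Parametrises by [G] the fiber of [direction d] over [c]; [line_param] recovers the parameter. *)
Definition line (G : zmodType) (d : 'I_3) (c x : G) : G * G :=
  match val d with 0%N => (c, x) | 1%N => (x, c) | _ => (x, c - x) end.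

Definition line_param (G : zmodType) (d : 'I_3) (p : G * G) : G :=
  if val d == 0%N then p.2 else p.1.

Lemma direction_line (G : zmodType) d (c x : G) : direction d (line d c x) = c.
Proof.
by case: d => -[|[|[|//]]] lt_d //; rewrite /direction /line /= addrC subrK.
Qed.

Lemma lineK (G : zmodType) d (c : G) : cancel (line d c) (line_param d).
Proof. by case: d => -[|[|[|//]]] lt_d x. Qed.

Lemma line_directionK (G : zmodType) d (p : G * G) :
  line d (direction d p) (line_param d p) = p.
Proof.
case: d p => -[|[|[|//]]] lt_d [x y]; rewrite /direction /line /line_param //=.
by rewrite addrC addKr.
Qed.

(** Any two of [x], [y] and [x + y] determine the third, by cancellation in [G]. *)
Lemma direction_orthogonal (G : zmodType) d e (p q : G * G) :
  d != e -> direction d p = direction d q -> direction e p = direction e q ->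
  p = q.
Proof.
case: d e p q => -[|[|[|//]]] ? [[|[|[|//]]] ?] [x y] [x' y'] //= _;
  rewrite /direction /=.
- by move=> -> ->.
- by move=> -> /addrI ->.
- by move=> -> ->.
- by move=> -> /addIr ->.
- by move=> + eq_x; rewrite eq_x => /addrI ->.
- by move=> + eq_y; rewrite eq_y => /addIr ->.
Qed.

(* The 4x4 array, listed by rows; its broken diagonals are i + j = c mod 4. *)
Definition seed_entries : seq int :=
  [:: -16; 11; 8; -3;  -1; -15; 9; 7;  13; -10; -5; 2;  4; 14; -12; -6].

Definition seed (p : 'I_4 * 'I_4) : int := seed_entries`_(4 * p.1 + p.2).

(** The twelve lines of the array are checked by computation. *)
Lemma seed_sum d c : \sum_x seed (line d c x) = 0.
Proof.
by case: d c => -[|[|[|//]]] ? [[|[|[|[|//]]]] ?];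
  rewrite !big_ord_recl big_ord0.
Qed.

(** This balance of signs is what makes a shift of absolute values cancel along a line. *)
Lemma seed_sgz_sum d c : \sum_x sgz (seed (line d c x)) = 0.
Proof.
by case: d c => -[|[|[|//]]] ? [[|[|[|[|//]]]] ?];
  rewrite !big_ord_recl big_ord0.
Qed.

Lemma seed_pos_sum d c : (\sum_x (0 < seed (line d c x))%R = 2)%N.
Proof.
by case: d c => -[|[|[|//]]] ? [[|[|[|[|//]]]] ?];
  rewrite !big_ord_recl big_ord0.
Qed.

Lemma seed_abs_bounds p : (0 < `|seed p| <= 16)%N.
Proof. by case: p => -[[|[|[|[|//]]]] ?] [[|[|[|[|//]]]] ?]. Qed.

Lemma seed_abs_inj : injective (fun p => `|seed p|%N).
Proof.
have /(uniqP 0%N) nth_inj : uniq [seq `|x|%N | x <- seed_entries] by [].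
have lt_index (p : 'I_4 * 'I_4) : (4 * p.1 + p.2 < size seed_entries)%N.
  by case: p => i j /=; move: (ltn_ord i) (ltn_ord j); lia.
move=> p q /= abs_pq.
have: (4 * p.1 + p.2 = 4 * q.1 + q.2)%N.
  apply: nth_inj; rewrite ?inE ?size_map ?lt_index //.
  by rewrite !(nth_map 0) ?lt_index.
case: p q {abs_pq} => i j [i' j'] /= eq_index.
move: (ltn_ord j) (ltn_ord j') => ? ?.
by congr pair; apply: val_inj => /=; lia.
Qed.

(** * The square array of shifted copies, with [m.+1] copies per side *)

Variable m : nat.

Notation index := ('I_m.+1 * 'I_4)%type.

(** Copies are numbered by rows; the stride 16 gives them consecutive, disjoint ranges of absolute
    values. *)
Definition offset (p : 'I_m.+1 * 'I_m.+1) : nat := (16 * (m.+1 * p.1 + p.2))%N.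

(** Here [(a, b)] locates the copy and [(i, j)] the cell in it; the factor [sgz] moves the entry
    away from zero and keeps its sign. *)
Definition entry (p : index * index) : int :=
  let: ((a, i), (b, j)) := p in
  seed (i, j) + sgz (seed (i, j)) * (offset (a, b))%:Z.

Lemma abs_entry a i b j :
  `|entry ((a, i), (b, j))|%N = (`|seed (i, j)| + offset (a, b))%N.
Proof. by move: (seed_abs_bounds (i, j)); rewrite /entry; case: sgzP; lia. Qed.

Lemma entry_gt0 a i b j : (0 < entry ((a, i), (b, j))) = (0 < seed (i, j)).
Proof. by move: (seed_abs_bounds (i, j)); rewrite /entry; case: sgzP; lia. Qed.

Lemma card_array : #|{: index * index}| = ((m.+1 * 4) ^ 2)%N.
Proof. by rewrite !card_prod !card_ord mulnn. Qed.

Lemma entry_abs_bounds p : (0 < `|entry p|%N <= #|{: index * index}|)%N.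
Proof.
rewrite card_array; case: p => -[a i] [b j]; rewrite abs_entry /offset /=.
move: (ltn_ord a) (ltn_ord b) (seed_abs_bounds (i, j)); nia.
Qed.

Lemma entry_abs_inj : injective (fun p => `|entry p|%N).
Proof.
move=> [[a i] [b j]] [[a' i'] [b' j']]; rewrite !abs_entry => eq_abs.
(* Offsets are multiples of 16 and seed values lie between 1 and 16, so the sum splits in only one
   way. *)
have [eq_seed eq_offset] : `|seed (i, j)|%N = `|seed (i', j')|%N
    /\ offset (a, b) = offset (a', b').
  move: (seed_abs_bounds (i, j)) (seed_abs_bounds (i', j')) eq_abs.
  by rewrite /offset; lia.
have [-> ->] := seed_abs_inj eq_seed.
move: (ltn_ord b) (ltn_ord b') eq_offset.
rewrite /offset /= => lt_b lt_b' eq_ab.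
have eq_a : a = a' by apply: val_inj => /=; nia.
have eq_b : b = b' by apply: val_inj => /=; move: eq_ab; rewrite eq_a; lia.
by rewrite eq_a eq_b.
Qed.

Lemma big_direction (R : Type) (idx : R) (op : Monoid.com_law idx)
    (F : index * index -> R) (d : 'I_3) (c : index) :
  \big[op/idx]_(p | @direction index d p == c) F p
    = \big[op/idx]_X \big[op/idx]_x F (@line index d c (X, x)).
Proof.
rewrite pair_bigA (reindex_onto (@line index d c) (@line_param index d))
  => [|p /eqP <-] /=.
  by apply: eq_big => [x|[X x] _] //; rewrite direction_line lineK !eqxx.
exact: line_directionK.
Qed.

Lemma card_direction d (c : index) :
  #|[pred p | @direction index d p == c]| = (m.+1 * 4)%N.
Proof.
rewrite -sum1_card big_direction /=.
by rewrite !sum_nat_const !card_ord muln1.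
Qed.

(** The group law is componentwise, so for fixed [X] the line stays in one copy and traces there a
    line of the 4x4 array in the same direction. *)
Lemma line_pair d (C X : 'I_m.+1) (c x : 'I_4) :
  @line index d (C, c) (X, x) = (((line d C X).1, (line d c x).1),
                          ((line d C X).2, (line d c x).2)).
Proof. by case: d => -[|[|[|//]]]. Qed.

Lemma entry_sum d (c : index) :
  \sum_(p | @direction index d p == c) entry p = 0.
Proof.
case: c => C c; rewrite big_direction big1 // => X _.
under eq_bigr => x _ do rewrite line_pair /entry -!surjective_pairing.
(* Within a copy the offset is constant, so it factors out of a sum of signs that vanishes. *)
by rewrite big_split -mulr_suml seed_sum seed_sgz_sum mul0r.
Qed.

Lemma entry_pos_sum d (c : index) :
  (\sum_(p | @direction index d p == c) (0 < entry p)%R = (m.+1 * 4)./2)%N.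
Proof.
case: c => C c; rewrite big_direction.
under eq_bigr => X _ do under eq_bigr => x _ do
  rewrite line_pair entry_gt0 -!surjective_pairing.
(* Each of the [m.+1] copies met by the line contributes two positive entries. *)
under eq_bigr => X _ do rewrite seed_pos_sum.
by rewrite sum_nat_const card_ord; lia.
Qed.

End ShiftedCopies.

Theorem theorem3p5 (n : nat) (n_gt0 : 0 < n) (n_mod4 : n = 0 %[mod 4]) :
  exists (V : {fset int}) (B : {fset {fset int}}),
    shiftable_Heffter_space (n ^ 2) n 3 V B.
Proof.
(* Positivity of [n] gives [n %/ 4 >= 1], so it is a successor. *)
have [m ->] : exists m, n = (m.+1 * 4)%N by exists (n %/ 4).-1; lia.
pose point_dir := @direction ('I_m.+1 * 'I_4)%type.
exists (points (@entry m)), (blocks (@entry m) point_dir).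
suff: shiftable_Heffter_space #|{: ('I_m.+1 * 'I_4) * ('I_m.+1 * 'I_4)}|
    (m.+1 * 4) #|'I_3| (points (@entry m)) (blocks (@entry m) point_dir).
  by rewrite card_array card_ord.
apply: fiber_shiftable; first exact: (ord0, ord0).
- exact: entry_abs_inj.
- exact: entry_abs_bounds.
- by rewrite mulSn.
- by rewrite oddM andbF.
- exact: card_direction.
- by move=> d e p q; apply: direction_orthogonal.
- exact: entry_sum.
- exact: entry_pos_sum.
Qed.
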